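(* Let $n\geq 2$ and let $f:(0,1)\to[0,1]^n$ be a measurable size cube packing (i.e. a Borel measurable map). For each $r\in(0,1)$ let $$G_r=\bigcup_{t\in(0,1)}\bigl(rt\,K_{n-1}+f(t)\bigr)\subset\mathbb{R}^n .$$ Then for Lebesgue almost every $r\in(0,1)$, $\dim_{\mathrm{H}} G_r=n$.
   Context: Let $K=[-0.5,0.5]^n\subset\mathbb{R}^n$ be the unit cube and $K_{n-1}=\partial K$ its topological boundary (the union of its $2n$ faces); all cubes are aligned with the coordinate axes. For $s>0$ and $x\in\mathbb{R}^n$, $sK_{n-1}+x=\{sy+x: y\in K_{n-1}\}$ is the boundary of the axis-parallel cube of side length $s$ centred at $x$. A size cube packing is a map $f:(0,1)\to[0,1]^n$, with image $T(f)=\bigcup_{t\in(0,1)}(tK_{n-1}+f(t))$; it is called measurable if $f$ is Borel measurable. $\dim_{\mathrm{H}}$ denotes Hausdorff dimension. *)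

(* Defs.v *)
From HB Require Import structures.
From mathcomp Require Import all_boot all_order all_algebra.
From mathcomp Require Import all_classical all_reals all_analysis.
Import Order.TTheory GRing.Theory Num.Theory numFieldNormedType.Exports.

Set Implicit Arguments.
Unset Strict Implicit.
Unset Printing Implicit Defensive.

Local Open Scope classical_set_scope.
Local Open Scope ring_scope.

(* Points of R^n are row vectors 'rV[R]_n, with the product topology. The
   library norm on 'rV[R]_n is the sup norm, so the Euclidean distance is
   introduced explicitly. *)

Section hausdorff_dimension.
Context {R : realType} {n : nat}.
Implicit Types (x y : 'rV[R]_n) (A U : set 'rV[R]_n) (s d : R).

Definition edist x y : R :=
  Num.sqrt (\sum_(i < n) (x ord0 i - y ord0 i) ^+ 2).

(* Equal to -oo when U is empty; see [diam_pow]. *)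
Definition diam U : \bar R :=
  ereal_sup [set (edist p.1 p.2)%:E | p in U `*` U].

(* (diam U)^s, with the conventions (diam set0)^s = 0 for every s (s = 0
   included) and (diam U)^0 = 1 for nonempty U. *)
Definition diam_pow s U : \bar R :=
  if U == set0 then 0%E else (diam U `^ s)%E.

Definition hausdorff_content s d A : \bar R :=
  ereal_inf [set (\sum_(0 <= i <oo) diam_pow s (U i))%E |
    U in [set U : nat -> set 'rV[R]_n |
      A `<=` \bigcup_i U i /\ (forall i, (diam (U i) <= d%:E)%E)]].

Definition hausdorff_measure s A : \bar R :=
  ereal_sup [set hausdorff_content s d A | d in [set d : R | 0 < d]].

Definition hausdorff_dim A : \bar R :=
  ereal_inf [set s%:E | s in [set s : R | 0 <= s /\ hausdorff_measure s A = 0%E]].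

End hausdorff_dimension.

Section size_cube_packing.
Context {R : realType} {n : nat}.
Implicit Types f : R -> 'rV[R]_n.

Definition centered_cube : set 'rV[R]_n :=
  [set x | forall i, - 2^-1 <= x ord0 i <= 2^-1].

Definition cube_boundary : set 'rV[R]_n :=
  closure centered_cube `\` interior centered_cube.

Definition cube_boundary_at (s : R) (x : 'rV[R]_n) : set 'rV[R]_n :=
  [set s *: y + x | y in cube_boundary].

(* A map (0,1) -> [0,1]^n is represented by a function on R of which only the
   values on ]0, 1[ are used. *)
Definition size_cube_packing f : Prop :=
  forall t, 0 < t < 1 -> forall i, 0 <= f t ord0 i <= 1.

(* The target carries the Borel sigma-algebra of R^n. *)
Definition measurable_size_cube_packing f : Prop :=
  size_cube_packing f /\
  measurable_fun (`]0, 1[ : set R)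
    (f : R -> g_sigma_algebraType (@open 'rV[R]_n)).

Definition scaled_packing_image f (r : R) : set 'rV[R]_n :=
  \bigcup_(t in `]0, 1[) cube_boundary_at (r * t) (f t).

End size_cube_packing.

(* Main.v *)
Require Import Defs.
From HB Require Import structures.
From mathcomp Require Import all_boot all_order all_algebra.
From mathcomp Require Import all_classical all_reals all_analysis.
From mathcomp Require Import measurable_realfun.
From mathcomp Require Import ring lra.
Import Order.TTheory GRing.Theory Num.Theory numFieldNormedType.Exports.
Local Open Scope classical_set_scope.
Local Open Scope ring_scope.

(** The upper bound is the trivial one: the set [G_r] lies in a bounded box,
and a box has zero [s]-dimensional measure for every [s > n]
([hausdorff_measure_box_eq0]).

For the lower bound only one face of each cube matters, the one on which the
first coordinate is largest.  In the cube of parameter [t] it is the product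
of the point [g_r(t) = f_1(t) + r t / 2] with an [(n-1)]-dimensional cube of
side [r t].  So [G_r] contains over each value [g_r(t)], with [1/2 < t < 1], a
cube of side at least [r / 2], and the problem becomes one-dimensional: the
values of [g_r] must be spread out on the line for almost every [r].

This is a transversality statement.  For [t <> t'] the difference
[g_r(t) - g_r(t')] is affine in [r] with slope [(t - t') / 2], so it is at most
[rho] in absolute value only on a set of [r] of measure at most
[4 rho / |t - t'|] ([measure_affine_near_le]).  Integrating the minimum of this
bound and [1] over [t'] costs a logarithm: with [rho = 2^-k], the triples
[(r, t, t')] for which [|g_r(t) - g_r(t')| <= 2^-k] have measure
[O((k + 1) 2^-k)] ([integral_near_mass]).  Dividing by slightly more than this
and summing over [k], Tonelli shows that for almost every [r] there are a set
[A] of parameters of positive measure and a constant [M] such that, for every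
[t] in [A] and every [k], the [t'] with [|g_r(t) - g_r(t')| <= 2^-k] have
measure at most [M (k + 1)^2 (k + 2) 2^-k] ([near_mass_bound_ae]).

Fix such an [r], and let [U_i] be a cover of [G_r] by sets of diameter [d_i].
For each [t] in [A] the sets that meet the face of [t] cover a cube of
dimension [n - 1], so the sum of [(2 d_i)^(n-1)] over these [i] is at least
[(r / 2)^(n-1)] ([fibre_cover]).  Integrating over [A], and using that those
[t] in [A] for which [g_r(t)] is within [d_i] of a given point have measure
almost [O(d_i)], bounds the sum of the [d_i^s] from below by a positive
constant, for every [s < n]: the logarithmic losses are absorbed by
[d_i^(n-s)] ([mass_le_powR]).  So the [s]-dimensional measure is not zero. *)

Set Implicit Arguments.
Unset Strict Implicit.
Unset Printing Implicit Defensive.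

(** * Series and Lebesgue measure *)

Lemma measurable_fun_nneseries d (T : measurableType d) (R : realType)
    (D : set T) (h : nat -> T -> \bar R) :
  (forall k x, D x -> (0 <= h k x)%E) ->
  (forall k, measurable_fun D (h k)) ->
  measurable_fun D (fun x => (\sum_(0 <= i <oo) h i x)%E).
Proof.
move=> h0 mh.
by apply: (@ge0_emeasurable_sum _ _ _ D h xpredT) => // k x Dx _; exact: h0.
Qed.

Lemma nneseries_ge_term (R : realType) (u : nat -> \bar R) (i : nat) :
  (forall k, (0 <= u k)%E) -> (u i <= \sum_(0 <= k <oo) u k)%E.
Proof.
move=> u0; rewrite (@nneseriesD1 _ _ i)//.
by rewrite leeDl// nneseries_ge0.
Qed.

Lemma nneseries_le_bound (R : realType) (u : nat -> R) (c : R) :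
  (forall k, 0 <= u k) -> (forall N, \sum_(k < N) u k <= c) ->
  (\sum_(0 <= k <oo) (u k)%:E <= c%:E)%E.
Proof.
move=> u0 uc; apply: lime_le.
  by apply: is_cvg_nneseries => k _ _; rewrite lee_fin.
by apply: nearW => N; rewrite sumEFin big_mkord lee_fin.
Qed.

Lemma le_lebesgue_measure (R : realType) (A B : set R) :
  measurable A -> measurable B -> A `<=` B ->
  (@lebesgue_measure R A <= @lebesgue_measure R B)%E.
Proof.
by move=> mA mB AB; apply: le_measure => //; apply: mem_set; [exact: mA|exact: mB].
Qed.

Lemma lebesgue_measure_dist_le (R : realType) (a d : R) : 0 <= d ->
  (@lebesgue_measure R [set y | (`|y - a| <= d)%R] = (2 * d)%:E)%E.
Proof.
move=> d0; have -> : [set y | `|y - a| <= d] = `[a - d, a + d]%classic.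
  by apply/seteqP; split => y /=; rewrite in_itv/= ler_distl.
rewrite lebesgue_measure_itv/= lte_fin -EFinB.
case: ltP => [_|ad]; first by congr EFin; lra.
by rewrite (_ : d = 0) ?mulr0//; lra.
Qed.

Lemma measurable_dist_le d (T : measurableType d) (R : realType)
    (phi : T -> R) (a : R) (e : R) :
  measurable_fun setT phi -> measurable [set y | `|phi y - a| <= e].
Proof.
move=> mphi; have -> : [set y | `|phi y - a| <= e] =
    setT `&` phi @^-1` `[a - e, a + e]%classic.
  by rewrite setTI; apply/seteqP; split => y /=; rewrite in_itv/= ler_distl.
exact: mphi.
Qed.

Lemma lebesgue_integral_indic (R : realType) (A : set R) : measurable A ->
  (\int[@lebesgue_measure R]_x (\1_A x)%:E = @lebesgue_measure R A)%E.
Proof.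
move=> mA; rewrite (integral_indic _ measurableT) ?setIT//; exact: mA.
Qed.

(** * Coverings of a cube *)

(** Integrated form of a pointwise covering bound: if the weights of the sets that
contain [x] add up to at least [c] for each [x] in [D], integrate over [D]. *)
Lemma mule_measure_le_nneseries d (T : measurableType d) (R : realType)
    (mu : {measure set T -> \bar R}) (D : set T) (E : nat -> set T)
    (b : nat -> R) (c : R) :
  measurable D -> (forall i, measurable (E i)) -> (forall i, 0 <= b i) ->
  0 <= c ->
  (forall x, D x -> (c%:E <= \sum_(0 <= i <oo) (b i * \1_(E i) x)%:E)%E) ->
  (c%:E * mu D <= \sum_(0 <= i <oo) ((b i)%:E * mu (E i `&` D)))%E.
Proof.
move=> mD mE b0 c0 cD.
have mF i : measurable_fun D (EFin \o (fun x => b i * \1_(E i) x)).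
  by apply/measurable_EFinP; exact: measurable_funM.
have F0 i x : D x -> (0 <= (b i * \1_(E i) x)%:E)%E.
  by move=> _; rewrite lee_fin mulr_ge0.
rewrite -integral_cst//.
have -> : (\sum_(0 <= i <oo) ((b i)%:E * mu (E i `&` D)) =
    \int[mu]_(x in D) \sum_(0 <= i <oo) (b i * \1_(E i) x)%:E)%E.
  rewrite integral_nneseries//; apply: eq_eseriesr => i _.
  under eq_integral do rewrite EFinM.
  rewrite ge0_integralZl_EFin//; last first.
    by apply/measurable_EFinP; exact: measurable_indic.
  by rewrite integral_indic.
apply: ge0_le_integral => //.
exact: measurable_fun_nneseries.
Qed.

(** Induction on the dimension replaces the product measure: fix the last
coordinate [y]; the boxes whose last side contains [y] cover a cube of one
dimension less, and integrating the resulting inequality over [y] yields one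
more factor [2 * d i].  The selection [P] of boxes is there for the induction,
which restricts it to the boxes that meet the slice at height [y].  A function
on [nat], read only below [m], serves as a point of dimension [m], so that all
dimensions share one type. *)
Lemma cube_volume_le_cover (R : realType) (m : nat) (c : nat -> R) (l : R)
    (P : pred nat) (a : nat -> nat -> R) (d : nat -> R) :
  0 <= l -> (forall i, 0 <= d i) ->
  (forall x : nat -> R, (forall j, (j < m)%N -> `|x j - c j| <= l / 2) ->
    exists2 i, P i & forall j, (j < m)%N -> `|x j - a i j| <= d i) ->
  ((l ^+ m)%:E <= \sum_(0 <= i <oo) (if P i then (2 * d i) ^+ m else 0)%:E)%E.
Proof.
move=> l0 d0; elim: m P => [|m IH] P cov.
  have [i Pi _] := cov c (fun j => ltac:(by [])).
  have pos k : (0 <= (if P k then (2 * d k) ^+ 0 else 0)%:E)%E.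
    by case: (P k); rewrite lee_fin.
  by apply: le_trans (nneseries_ge_term i pos); rewrite Pi.
rewrite exprSr EFinM.
pose D := [set y : R | `|y - c m| <= l / 2].
have -> : l%:E = lebesgue_measure D by rewrite lebesgue_measure_dist_le//; [congr EFin; lra|lra].
pose E i := [set y : R | `|y - a i m| <= d i].
have mD : measurable D by exact: measurable_dist_le.
have mE i : measurable (E i) by exact: measurable_dist_le.
pose b i := if P i then (2 * d i) ^+ m else 0.
have b0 i : 0 <= b i by rewrite /b; case: (P i) => //; rewrite exprn_ge0// mulr_ge0.
apply: (@le_trans _ _ (\sum_(0 <= i <oo) ((b i)%:E * lebesgue_measure (E i `&` D)))%E).
  apply: mule_measure_le_nneseries => //; first by rewrite exprn_ge0.
  move=> y Dy; pose Q i := P i && (`|y - a i m| <= d i).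
  apply: le_trans (IH Q _) _.
    move=> x xc.
    (* The slice is covered because [x], completed by [y], is a point of the
       full cube. *)
    pose x' j := if j == m then y else x j.
    have [j|i Pi xi] := cov x'.
      rewrite /x' ltnS leq_eqVlt; case: eqP => [-> _|_] //=; exact: xc.
    exists i.
      by rewrite /Q Pi/=; have := xi m (leqnn _); rewrite /x' eqxx.
    move=> j jm; have := xi j (ltnW jm).
    by rewrite /x' ltn_eqF.
  apply: lee_nneseries => [i _ _|i _].
    by rewrite lee_fin; case: (Q i) => //; rewrite exprn_ge0// mulr_ge0.
  rewrite lee_fin /Q /b indicE.
  case: (P i) => /=; last by rewrite mul0r.
  case: ifPn => [yi|yi].
    by rewrite mem_set// mulr1.
  by rewrite mulr_ge0// exprn_ge0// mulr_ge0.
apply: lee_nneseries => [i _ _|i _].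
  by rewrite mule_ge0// lee_fin.
apply: (@le_trans _ _ ((b i)%:E * lebesgue_measure (E i))%E).
  apply: lee_wpmul2l; first by rewrite lee_fin.
  by apply: le_lebesgue_measure => //; exact: measurableI.
rewrite lebesgue_measure_dist_le// -EFinM lee_fin /b.
by case: (P i); rewrite ?mul0r// exprSr.
Qed.

(** * Transversality of the faces *)

(** The first coordinate of the face of the cube of parameter [t] on which that
coordinate is largest, when [h] is the first coordinate of the centres; [r] is
the factor by which the cubes are scaled. *)
Definition face_height {R : realType} (h : R -> R) (r t : R) : R := h t + r * (t / 2).

(** Triples [((r, t), t')], grouped so that a section over [(r, t)] is a set of
[t'].  Parameters below [1/2] are discarded to keep the cubes large; the
difference of heights is compared with [0] to match [measurable_dist_le]. *)
Definition near_triples {R : realType} (h : R -> R) (k : nat) :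
    set (R * R * R) :=
  ((`]0, 1[ `*` `]2^-1, 1[) `*` `]2^-1, 1[) `&`
  [set z | `|(face_height h z.1.1 z.1.2 - face_height h z.1.1 z.2) - 0| <= 2^-1 ^+ k].

Lemma measurable_face_height (R : realType) (h : R -> R) (r : R) :
  measurable_fun setT h -> measurable_fun setT (face_height h r).
Proof.
move=> mh; apply: measurable_funD => //.
by apply: measurable_funM => //; apply: measurable_funM.
Qed.

Lemma measurable_near_triples (R : realType) (h : R -> R) (k : nat) :
  measurable_fun setT h -> measurable (near_triples h k).
Proof.
move=> mh; apply: measurableI.
  by apply: measurableX; [apply: measurableX|]; exact: measurable_itv.
apply: measurable_dist_le.
have m1 : measurable_fun setT (fun z : R * R * R => z.1.1).
  exact: measurableT_comp.
have m2 : measurable_fun setT (fun z : R * R * R => z.1.2).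
  exact: measurableT_comp.
have m3 : measurable_fun setT (fun z : R * R * R => z.2).
  exact: measurable_snd.
apply: measurable_funB; apply: measurable_funD.
- exact: (measurableT_comp mh m2).
- by apply: measurable_funM => //; apply: measurable_funM.
- exact: (measurableT_comp mh m3).
- by apply: measurable_funM => //; apply: measurable_funM.
Qed.

Definition near_mass {R : realType} (h : R -> R) (k : nat) (p : R * R) : \bar R :=
  @lebesgue_measure R (xsection (near_triples h k) p).

Lemma near_mass_ge0 (R : realType) (h : R -> R) k p : (0 <= near_mass h k p)%E.
Proof. exact: measure_ge0. Qed.

Lemma measurable_near_mass (R : realType) (h : R -> R) k :
  measurable_fun setT h -> measurable_fun setT (near_mass h k).
Proof.
move=> mh; apply: (measurable_fun_xsection (@lebesgue_measure R)).
exact: measurable_near_triples.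
Qed.

(** The left-hand side is at most the minimum of [1] and [4 * 2^-k / |b|].  The
term of the sum for the least [j] with [|b| <= 2^j * 2^-k] alone is at least
this minimum, and the sum is easy to integrate in [b]. *)
Lemma measure_affine_near_le (R : realType) (a b : R) (k : nat) : `|b| <= 1 ->
  (@lebesgue_measure R (`]0%R, 1%R[ `&` [set r | (`|a + r * (b / 2)| <= 2^-1 ^+ k)%R]) <=
   (\sum_(j < k.+1) 8 * 2^-1 ^+ j * \1_[set y : R | `|y - 0| <= 2 ^+ j * 2^-1 ^+ k] b)%:E)%E.
Proof.
move=> b1; set S := (X in lebesgue_measure X).
pose T j := 8 * 2^-1 ^+ j * \1_[set y : R | `|y - 0| <= 2 ^+ j * 2^-1 ^+ k] b : R.
have p0 j : (0 : R) < 2^-1 ^+ j by rewrite exprn_gt0// invr_gt0.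
have q0 j : (0 : R) < 2 ^+ j by rewrite exprn_gt0.
have T0 j : 0 <= T j by rewrite /T !mulr_ge0// ltW.
have mslab (phi : R -> R) : measurable_fun setT phi ->
    measurable [set r | `|phi r| <= 2^-1 ^+ k].
  move=> mphi; have := measurable_dist_le 0 (2^-1 ^+ k) mphi.
  by under eq_set do rewrite subr0.
have mS0 : measurable [set r : R | `|a + r * (b / 2)| <= 2^-1 ^+ k].
  apply: mslab; apply: measurable_funD => //; exact: measurable_funM.
have mS : measurable S by apply: measurableI => //; exact: measurable_itv.
have key j : (j <= k)%N -> `|b| <= 2 ^+ j * 2^-1 ^+ k ->
    (lebesgue_measure S <= (8 * 2^-1 ^+ j)%:E)%E ->
    (lebesgue_measure S <= (\sum_(j < k.+1) T j)%:E)%E.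
  move=> jk bj /le_trans; apply; rewrite lee_fin.
  rewrite (bigD1 (inord j))//= {1}/T inordK// indicE mem_set/= ?subr0// mulr1.
  by rewrite lerDl; apply: sumr_ge0.
(* Some [j <= k] qualifies because [|b| <= 1]. *)
have kP : `|b| <= 2 ^+ k * 2^-1 ^+ k by rewrite -exprMn mulfV// expr1n.
have exj : exists j, `|b| <= 2 ^+ j * 2^-1 ^+ k by exists k.
have [j] := ex_minnP exj.
case: j => [|j] bj jmin.
  apply: (key 0%N) => //; apply: (@le_trans _ _ (lebesgue_measure (`]0%R, 1%R[ : set R))).
    by apply: le_lebesgue_measure => //; move=> x [].
  rewrite lebesgue_measure_itv/= lte_fin ltr01 -EFinB lee_fin expr0; lra.
apply: (key j.+1) => //.
  exact: jmin.
have bj' : 2 ^+ j * 2^-1 ^+ k < `|b|.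
  by rewrite ltNge; apply/negP => /jmin; rewrite ltnn.
have b0 : 0 < `|b| by apply: lt_trans bj'; rewrite mulr_gt0.
have b_neq0 : b != 0 by rewrite -normr_gt0.
pose e := 2 * 2^-1 ^+ k / `|b|.
have e0 : 0 <= e by rewrite /e divr_ge0// mulr_ge0// ltW.
apply: (@le_trans _ _ (lebesgue_measure [set r | `|r - (- (2 * a / b))| <= e]%R)).
  apply: le_lebesgue_measure => //; first exact: measurable_dist_le.
  move=> r [_ /=]; rewrite /e ler_pdivlMr// -normrM => H.
  have -> : (r - - (2 * a / b)) * b = 2 * (a + r * (b / 2)) by field.
  by rewrite normrM ger0_norm// ler_pM2l.
rewrite lebesgue_measure_dist_le// lee_fin /e mulrA ler_pdivrMr//.
have -> : 8 * 2^-1 ^+ j.+1 * `|b| = (4 * 2^-1 ^+ j) * `|b| :> R.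
  by rewrite exprS mulrA; congr (_ * _ * _); lra.
apply: (@le_trans _ _ (4 * 2^-1 ^+ j * (2 ^+ j * 2^-1 ^+ k))).
  rewrite -mulrA (mulrA (2^-1 ^+ j)) -exprMn mulVf// expr1n mul1r; lra.
by apply: ler_wpM2l (ltW bj'); rewrite mulr_ge0// ltW.
Qed.

(** Exchange the integrals in [r] and [t'] and apply transversality in [r].  Each
of the [k + 1] terms of the dyadic majorant has integral [16 * 2^-k] in [t'],
which is where the logarithmic factor [k + 1] comes from. *)
Lemma integral_near_mass_slice (R : realType) (h : R -> R) (k : nat) (t : R) :
  measurable_fun setT h ->
  (\int[@lebesgue_measure R]_r near_mass h k (r, t) <=
   (16 * k.+1%:R * 2^-1 ^+ k)%:E * (\1_`]2^-1, 1[ t)%:E)%E.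
Proof.
move=> mh; pose S := near_triples h k.
have mS : measurable S by exact: measurable_near_triples.
have [tJ|tJ] := boolP (t \in `]2^-1, 1[%classic); last first.
  rewrite indicE (negbTE tJ) mule0 integral0_eq// => r _.
  rewrite /near_mass (_ : xsection _ _ = set0) ?measure0//.
  apply/seteqP; split => // t' /xsectionP [] [] [_ /= tJ' _ _].
  by move/negP: tJ; apply; apply/mem_set.
rewrite indicE tJ mule1.
pose f (p : R * R) : \bar R := (\1_S ((p.1, t), p.2))%:E.
have mf : measurable_fun setT f.
  apply/measurable_EFinP; apply: (measurableT_comp (measurable_indic mS)).
  apply: measurable_fun_pair => //; exact: measurable_fun_pair.
have f0 p : (0 <= f p)%E by rewrite lee_fin.
have -> : (\int[@lebesgue_measure R]_r near_mass h k (r, t) =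
    \int[@lebesgue_measure R]_r \int[@lebesgue_measure R]_t' f (r, t'))%E.
  apply: eq_integral => r _.
  rewrite /near_mass -lebesgue_integral_indic//; last first.
    exact: measurable_xsection.
  apply: eq_integral => t' _; rewrite /f !indicE; congr (_%:R%:E).
  congr nat_of_bool; apply/idP/idP; rewrite !inE.
    by move/xsectionP.
  by move=> ?; apply/xsectionP.
rewrite (@fubini_tonelli _ _ _ _ R (@lebesgue_measure R) (@lebesgue_measure R) f mf f0).
pose E j := [set t' : R | `|(t - t') - 0| <= 2 ^+ j * 2^-1 ^+ k].
have mE j : measurable (E j).
  by apply: measurable_dist_le; exact: measurable_funB.
have p0 j : (0 : R) <= 8 * 2^-1 ^+ j.
  by rewrite mulr_ge0// exprn_ge0// invr_ge0.
pose K t' : \bar R := (\sum_(j < k.+1) (8 * 2^-1 ^+ j)%:E * (\1_(E j) t' : R)%:E)%E.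
have K0 t' : (0 <= K t')%E.
  by apply: sume_ge0 => j _; apply: mule_ge0; rewrite lee_fin.
have m1 j : measurable_fun setT (fun t' => (\1_(E j) t' : R)%:E).
  by apply/measurable_EFinP; exact: measurable_indic.
have mK j : measurable_fun setT (fun t' => (8 * 2^-1 ^+ j)%:E * (\1_(E j) t' : R)%:E)%E.
  exact: measurable_funeM.
apply: (@le_trans _ _ (\int[@lebesgue_measure R]_t' K t')%E).
  apply: ge0_le_integral => //.
  - by move=> t' _; exact: integral_ge0.
  - exact: measurable_fun_fubini_tonelli_G.
  - by apply: emeasurable_sum => j _; exact: mK.
  move=> t' _.
  have [t'J|t'J] := pselect (`]2^-1, 1[%classic t'); last first.
    rewrite integral0_eq// => r _; rewrite /f indicE memNset//= => -[] [_ /=] /t'J [].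
  have -> : (\int[@lebesgue_measure R]_r f (r, t') = @lebesgue_measure R (`]0%R, 1%R[ `&`
      [set r | (`|(h t - h t') + r * ((t - t') / 2)| <= 2^-1 ^+ k)%R]))%E.
    rewrite -lebesgue_integral_indic//; last first.
      apply: measurableI; first exact: measurable_itv.
      have mphi : measurable_fun setT (fun r : R => (h t - h t') + r * ((t - t') / 2)).
        by apply: measurable_funD => //; exact: measurable_funM.
      by have := measurable_dist_le 0 (2^-1 ^+ k) mphi; under eq_set do rewrite subr0.
    apply: eq_integral => r _; rewrite /f !indicE; congr (_%:R%:E).
    have eqg : h t + r * (t / 2) - (h t' + r * (t' / 2)) - 0 =
      h t - h t' + r * ((t - t') / 2) by field.
    congr nat_of_bool; apply/idP/idP; rewrite !inE /S /near_triples /face_height /= eqg.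
      by move=> [[[r01 _] _] H]; split.
    by move=> [r01 H]; split=> //; split=> //; split=> //; exact/set_mem.
  apply: le_trans (measure_affine_near_le _ _ _) _.
    move: tJ t'J; rewrite inE/= !in_itv/= ler_norml => ? ?; lra.
  rewrite -sumEFin /K; apply: lee_sum => j _.
  by rewrite -EFinM lee_fin !indicE.
rewrite ge0_integral_sum//; last first.
  by move=> j; exact: mK.
have -> : 16 * k.+1%:R * 2^-1 ^+ k = \sum_(j < k.+1) (16 * 2^-1 ^+ k) :> R.
  by rewrite sumr_const card_ord -mulr_natr; ring.
rewrite -sumEFin; apply: lee_sum => j _.
rewrite ge0_integralZl_EFin//; last first.
  exact: m1.
rewrite lebesgue_integral_indic//.
have -> : E j = [set t' | `|t' - t| <= 2 ^+ j * 2^-1 ^+ k].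
  by apply/seteqP; split => t' /=; rewrite /E/= subr0 distrC.

rewrite lebesgue_measure_dist_le ?mulr_ge0 ?exprn_ge0// -EFinM lee_fin.
have -> : 8 * 2^-1 ^+ j * (2 * (2 ^+ j * 2^-1 ^+ k)) =
  16 * (2^-1 ^+ j * 2 ^+ j) * 2^-1 ^+ k :> R by ring.
by rewrite -exprMn mulVf// expr1n mulr1.
Qed.
Lemma integral_near_mass (R : realType) (h : R -> R) (k : nat) :
  measurable_fun setT h ->
  (\int[@lebesgue_measure R]_r \int[@lebesgue_measure R]_t near_mass h k (r, t)
   <= (8 * k.+1%:R * 2^-1 ^+ k)%:E)%E.
Proof.
move=> mh.
have mN : measurable_fun setT (near_mass h k) by exact: measurable_near_mass.
rewrite (@fubini_tonelli _ _ _ _ R (@lebesgue_measure R) (@lebesgue_measure R)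
  (near_mass h k) mN)//.
pose c : R := 16 * k.+1%:R * 2^-1 ^+ k.
have c0 : 0 <= c by rewrite !mulr_ge0// exprn_ge0.
have m1 : measurable_fun setT (fun t : R => (\1_`]2^-1, 1[ t : R)%:E).
  by apply/measurable_EFinP; apply: measurable_indic; exact: measurable_itv.
apply: (@le_trans _ _ (\int[@lebesgue_measure R]_t (c%:E * (\1_`]2^-1, 1[ t)%:E))%E).
  apply: ge0_le_integral => //.
  - by move=> t _; apply: integral_ge0 => r _; exact: near_mass_ge0.
  - exact: measurable_fun_fubini_tonelli_G.
  - exact: measurable_funeM.
  - by move=> t _; exact: integral_near_mass_slice.
rewrite ge0_integralZl_EFin//.
rewrite lebesgue_integral_indic; last exact: measurable_itv.
rewrite lebesgue_measure_itv/= lte_fin -EFinB.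
rewrite ifT; last lra.
by rewrite -EFinM lee_fin /c; rewrite le_eqVlt; apply/orP; left; apply/eqP; field.
Qed.

(** One factor [k + 1] offsets the logarithmic loss in the bound of order
[(k + 1) * 2^-k] for the measure of near triples; the two others make
the remaining series [1 / ((k + 1) (k + 2))] telescope. *)
Definition near_weight {R : realType} (k : nat) : R :=
  2 ^+ k / (k.+1%:R ^+ 2 * k.+2%:R).

Lemma near_weight_gt0 (R : realType) k : 0 < near_weight k :> R.
Proof. by rewrite /near_weight divr_gt0// ?mulr_gt0// exprn_gt0. Qed.

(** A discrete form of an energy integral: the kernel is the step function of
[|g_r(t) - g_r(t')|] with weight [near_weight k] at scale [2^-k], close to the
inverse of the distance up to powers of its logarithm. *)
Definition near_energy {R : realType} (h : R -> R) (p : R * R) : \bar R :=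
  (\sum_(0 <= k <oo) (near_weight k)%:E * near_mass h k p)%E.

Lemma near_energy_ge0 (R : realType) (h : R -> R) p : (0 <= near_energy h p)%E.
Proof.
apply: nneseries_ge0 => k _ _.
by rewrite mule_ge0 ?near_mass_ge0// lee_fin ltW// near_weight_gt0.
Qed.

Lemma measurable_near_energy (R : realType) (h : R -> R) :
  measurable_fun setT h -> measurable_fun setT (near_energy h).
Proof.
move=> mh; apply: measurable_fun_nneseries => [k p _|k].
  by rewrite mule_ge0 ?near_mass_ge0// lee_fin ltW// near_weight_gt0.
by apply: measurable_funeM; exact: measurable_near_mass.
Qed.

Lemma integral_near_energy (R : realType) (h : R -> R) :
  measurable_fun setT h ->
  (\int[@lebesgue_measure R]_r \int[@lebesgue_measure R]_t near_energy h (r, t)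
   <= 8%:E)%E.
Proof.
move=> mh.
have w0 k : 0 <= near_weight k :> R by rewrite ltW// near_weight_gt0.
have inner r : (\int[@lebesgue_measure R]_t near_energy h (r, t) =
    \sum_(0 <= k <oo) (near_weight k)%:E *
      \int[@lebesgue_measure R]_t near_mass h k (r, t))%E.
  rewrite integral_nneseries//; last 2 first.
  - move=> k; apply: measurable_funeM.
    apply: (measurableT_comp (measurable_near_mass k mh)).
    exact: measurable_pair1.
  - by move=> k t _; rewrite mule_ge0 ?near_mass_ge0// lee_fin.
  apply: eq_eseriesr => k _; rewrite ge0_integralZl_EFin//.
  apply: (measurableT_comp (measurable_near_mass k mh)).
  exact: measurable_pair1.
under eq_integral do rewrite inner.
have mI k : measurable_fun setT (fun r => \int[@lebesgue_measure R]_t near_mass h k (r, t))%E.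
  apply: measurable_fun_fubini_tonelli_F; first exact: measurable_near_mass.
  by move=> p; exact: near_mass_ge0.
have I0 k r : (0 <= \int[@lebesgue_measure R]_t near_mass h k (r, t))%E.
  by apply: integral_ge0 => t _; exact: near_mass_ge0.
rewrite integral_nneseries//; last 2 first.
- by move=> k; apply: measurable_funeM; exact: mI.
- by move=> k r _; rewrite mule_ge0// lee_fin.
apply: (@le_trans _ _ (\sum_(0 <= k <oo) (8 * (k.+1%:R^-1 - k.+2%:R^-1))%:E)%E).
  apply: lee_nneseries => [k _ _|k _].
    by apply: integral_ge0 => r _; rewrite mule_ge0// lee_fin.
  rewrite ge0_integralZl_EFin//; last exact: mI.
  apply: (@le_trans _ _ ((near_weight k)%:E * (8 * k.+1%:R * 2^-1 ^+ k)%:E)%E).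
    by apply: lee_wpmul2l; rewrite ?lee_fin//; exact: integral_near_mass.
  rewrite -EFinM lee_fin /near_weight le_eqVlt; apply/orP; left; apply/eqP.
  have -> : (2^-1 : R) ^+ k = (2 ^+ k)^-1 by rewrite exprVn.
  field.
  have k0 : 0 <= k%:R :> R by [].
  by apply/and3P; split; rewrite gt_eqF ?exprn_gt0//; lra.
apply: nneseries_le_bound => [k|N].
  by rewrite mulr_ge0// subr_ge0 lef_pV2 ?posrE// ler_nat.
rewrite -mulr_sumr -[leRHS]mulr1 ler_pM2l//.
suff -> : \sum_(k < N) (k.+1%:R^-1 - k.+2%:R^-1) = 1 - N.+1%:R^-1 :> R.
  by rewrite lerBlDr lerDl invr_ge0.
elim: N => [|N IH]; first by rewrite big_ord0 invr1 subrr.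
by rewrite big_ord_recr/= IH addrA subrK.
Qed.

(** By Tonelli the energy is integrable in [t] for almost every [r], and Markov's
inequality bounds it on a set [A] of positive measure; each term of the energy
is then bounded as well. *)
Lemma near_mass_bound_ae (R : realType) (h : R -> R) :
  measurable_fun setT h ->
  {ae @lebesgue_measure R, forall r : R, exists (A : set R) (M : R),
    [/\ measurable A, A `<=` `]2^-1, 1[%classic,
        (0 < @lebesgue_measure R A)%E, 0 < M &
        forall t k, A t -> (near_mass h k (r, t) <= (M / near_weight k)%:E)%E]}.
Proof.
move=> mh.
have mE := measurable_near_energy mh.
have mF : measurable_fun setT
    (fun r => \int[@lebesgue_measure R]_t near_energy h (r, t))%E.
  by apply: measurable_fun_fubini_tonelli_F => // p; exact: near_energy_ge0.
have iF : (@lebesgue_measure R).-integrable setT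
    (fun r => \int[@lebesgue_measure R]_t near_energy h (r, t))%E.
  apply/integrableP; split; first exact: mF.
  under eq_integral => r _.
    rewrite gee0_abs; last by apply: integral_ge0 => t _; exact: near_energy_ge0.
    over.
  by rewrite (le_lt_trans (integral_near_energy mh))// ltry.
apply: filterS (integrable_ae measurableT iF) => r /(_ Logic.I).
set F := (X in X \is a fin_num) => Ffin.
have F0 : (0 <= F)%E by apply: integral_ge0 => t _; exact: near_energy_ge0.
pose V := fine F; have V0 : 0 <= V by exact: fine_ge0.
have FV : F = V%:E by rewrite /V fineK.
(* The interval has length 1/2, and Markov's inequality leaves less than half
   of it outside [A] with this constant. *)
pose M := 4 * V + 4; have M0 : 0 < M by rewrite /M; lra.
have mEr : measurable_fun setT (fun t => near_energy h (r, t)).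
  exact: (measurableT_comp mE (measurable_pair1 r)).
pose B := [set t | (M%:E <= `|near_energy h (r, t)|)%E].
have mB : measurable B.
  rewrite /B -[X in measurable X]setTI.
  apply: emeasurable_fun_c_infty => //; exact: measurableT_comp.
have MB : (M%:E * @lebesgue_measure R B <= V%:E)%E.
  have := @le_integral_comp_abse _ _ R (@lebesgue_measure R) setT measurableT
    (fun t => near_energy h (r, t)) M id (@measurable_id _ _ _)
    (fun _ H => H) (fun _ _ _ _ H => H) mEr M0.
  rewrite setTI => /le_trans; apply; rewrite -FV /F.
  by under eq_integral do rewrite gee0_abs ?near_energy_ge0//.
pose J : set R := `]2^-1, 1[%classic; have mJ : measurable J by exact: measurable_itv.
exists (J `\` B), M; split => //.
- exact: measurableD.
- rewrite lt_neqAle measure_ge0 andbT eq_sym; apply/negP => /eqP A0.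
  have : (@lebesgue_measure R J <= @lebesgue_measure R B)%E.
    have -> : @lebesgue_measure R J =
        (@lebesgue_measure R (J `\` B) + @lebesgue_measure R (J `&` B))%E.
      exact: measureDI.
    rewrite A0 add0e; apply: le_lebesgue_measure => //.
    exact: measurableI.
  rewrite lebesgue_measure_itv/= lte_fin -EFinB ifT; last lra.
  move=> JB; have := le_trans (lee_wpmul2l (_ : (0 <= M%:E)%E) JB) MB.
  by rewrite lee_fin (ltW M0) => /(_ isT); rewrite -EFinM lee_fin /M; lra.
move=> t k [_ /= /negP]; rewrite -ltNge gee0_abs ?near_energy_ge0// => tB.
rewrite mulrC EFinM lee_pdivlMl ?near_weight_gt0//.
apply: le_trans (ltW tB).
apply: (@nneseries_ge_term R
  (fun k => (near_weight k)%:E * near_mass h k (r, t))%E) => j.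
by rewrite mule_ge0 ?near_mass_ge0// lee_fin ltW// near_weight_gt0.
Qed.

(** * Distances and faces of the cube *)

Lemma coord_le_edist (R : realType) (n : nat) (x y : 'rV[R]_n) (j : 'I_n) :
  `|x ord0 j - y ord0 j| <= Defs.edist x y.
Proof.
rewrite -sqrtr_sqr ler_wsqrtr// (bigD1 j)//= lerDl.
by apply: sumr_ge0 => i _; exact: sqr_ge0.
Qed.

Lemma edist_le_diam (R : realType) (n : nat) (U : set 'rV[R]_n)
    (x y : 'rV[R]_n) : U x -> U y -> ((Defs.edist x y)%:E <= diam U)%E.
Proof. by move=> Ux Uy; apply: ereal_sup_ubound; exists (x, y). Qed.

Lemma diam_ge0 (R : realType) (n : nat) (U : set 'rV[R]_n) :
  U !=set0 -> (0 <= diam U)%E.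
Proof.
move=> [x Ux]; apply: le_trans (edist_le_diam Ux Ux).
by rewrite lee_fin sqrtr_ge0.
Qed.

Lemma closure_coord_le (R : realType) (n : nat) (C : set 'rV[R]_n)
    (y : 'rV[R]_n) (j : 'I_n) (c : R) :
  (forall x, C x -> `|x ord0 j| <= c) -> closure C y -> `|y ord0 j| <= c.
Proof.
move=> Cc Cy; apply/ler_addgt0Pr => e e0.
have [x [/Cc xc]] := Cy _ (nbhsx_ballx y e e0).
move=> [_ /(_ ord0 j)]; rewrite -ball_normE/= => /ltW yxj.
have -> : y ord0 j = x ord0 j + (y ord0 j - x ord0 j) by ring.
by apply: le_trans (ler_normD _ _) _; apply: lerD.
Qed.

(** Such a point is not interior: increasing its first coordinate leaves the
cube. *)
Lemma face_cube_boundary (R : realType) (m : nat) (y : 'rV[R]_m.+1) :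
  y ord0 ord0 = 2^-1 -> (forall j, `|y ord0 j| <= 2^-1) -> cube_boundary y.
Proof.
move=> y0 yj; split.
  by apply: subset_closure => j; rewrite -ler_norml.
move=> /nbhs_ballP[e /= e0 ye].
pose z : 'rV[R]_m.+1 := \row_j (if j == ord0 then 2^-1 + e / 2 else y ord0 j).
have : ball y e z.
  split=> // i j; rewrite (ord1 i) -ball_normE/= mxE.
  case: eqP => [->|_]; last by rewrite subrr normr0.
  rewrite y0 opprD addrA subrr sub0r normrN ger0_norm; lra.
by move=> /ye /(_ ord0); rewrite mxE eqxx; lra.
Qed.

(** * Upper bound *)

Lemma diam_le (R : realType) (n : nat) (U : set 'rV[R]_n) (d : R) :
  (forall x y, U x -> U y -> Defs.edist x y <= d) -> (diam U <= d%:E)%E.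
Proof.
move=> Ud; apply: ge_ereal_sup => _ [[x y] [/= Ux Uy] <-].
by rewrite lee_fin; exact: Ud.
Qed.

Lemma edist_le_coord (R : realType) (n : nat) (x y : 'rV[R]_n) (d : R) :
  0 <= d -> (forall j, `|x ord0 j - y ord0 j| <= d) ->
  Defs.edist x y <= n%:R * d.
Proof.
move=> d0 xyd; have nd0 : 0 <= n%:R * d by rewrite mulr_ge0.
rewrite -(ger0_norm nd0) -sqrtr_sqr ler_wsqrtr//.
apply: (@le_trans _ _ (\sum_(i < n) d ^+ 2)).
  by apply: ler_sum => i _; rewrite -real_normK ?num_real// lerXn2r ?nnegrE.
rewrite sumr_const card_ord -[leLHS]mulr_natl exprMn.
apply: ler_wpM2r; first exact: sqr_ge0.
by rewrite -natrX ler_nat; case: (n) => // k; rewrite -mulnn leq_pmulr.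
Qed.

(** Cut the box into [N^n] equal cells of diameter at most [D / N]; the sum of the
[s]-th powers is at most [N^n (D / N)^s], which tends to zero. *)
Lemma hausdorff_measure_box_eq0 (R : realType) (n : nat) (s : R)
    (G : set 'rV[R]_n) (a l : R) :
  0 < l -> n%:R < s -> (forall x j, G x -> a <= x ord0 j <= a + l) ->
  hausdorff_measure s G = 0%E.
Proof.
move=> l0 ns Gbox; have s0 : 0 < s by apply: le_lt_trans ns.
apply/eqP; rewrite eq_le; apply/andP; split; last first.
  apply: (@le_trans _ _ (hausdorff_content s 1 G)).
    apply: le_ereal_inf_tmp => _ [U _ <-]; apply: nneseries_ge0 => i _ _.
    by rewrite /diam_pow; case: ifP => // _; exact: poweR_ge0.
  by apply: ereal_sup_ubound; exists 1 => //=; exact: ltr01.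
apply: ge_ereal_sup => _ [d /= d0 <-].
apply/lee_addgt0Pr => e e0; rewrite add0e.
pose D : R := n%:R * l + 1.
have D0 : 0 < D by rewrite ltr_wpDl// mulr_ge0// ltW.
suff [N [N0 Nd Ne]] : exists N : nat, [/\ (0 < N)%N, D / N%:R <= d &
    (N ^ n)%:R * (D / N%:R) `^ s <= e].
  have NR0 : 0 < N%:R :> R by rewrite ltr0n.
  pose T := {ffun 'I_n -> 'I_N}.
  pose cell (phi : T) : set 'rV[R]_n :=
    [set x | forall j, a + (phi j)%:R * (l / N%:R) <= x ord0 j <=
                       a + (phi j).+1%:R * (l / N%:R)].
  pose U i : set 'rV[R]_n :=
    if insub i is Some k then cell (enum_val (k : 'I_#|T|)) else set0.
  have cell_diam phi : (diam (cell phi) <= (D / N%:R)%:E)%E.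
    apply: diam_le => x y xc yc.
    apply: (@le_trans _ _ (n%:R * (l / N%:R))).
      apply: edist_le_coord => [|j]; first by rewrite divr_ge0// ltW.
      have /andP[x1 x2] := xc j; have /andP[y1 y2] := yc j.
      move: x1 x2 y1 y2; rewrite -natr1 mulrDl mul1r.
      by rewrite ler_norml; lra.
    by rewrite mulrA ler_pM2r ?invr_gt0// /D lerDl.
  have Ud i : (diam (U i) <= (D / N%:R)%:E)%E.
    rewrite /U; case: insub => [k|]; first exact: cell_diam.
    by apply: diam_le => x y [].
  apply: (@le_trans _ _ (\sum_(0 <= i <oo) diam_pow s (U i))%E).
    apply: ereal_inf_lbound; exists U => //; split; last first.
      by move=> i; apply: le_trans (Ud i) _; rewrite lee_fin.
    move=> x Gx.
    (* The minimum puts the upper end of the box into the last cell. *)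
    pose w := l / N%:R; have w0 : 0 < w by rewrite divr_gt0.
    pose c j := (x ord0 j - a) / w.
    have cN j : 0 <= c j <= N%:R.
      have /andP[x1 x2] := Gbox x j Gx.
      rewrite divr_ge0 ?subr_ge0 ?(ltW w0)//= ler_pdivrMr// /w mulrCA mulfV ?gt_eqF//.
      by rewrite mulr1 lerBlDl.
    have kN j : (minn (Num.truncn (c j)) N.-1 < N)%N.
      by rewrite (leq_ltn_trans (geq_minr _ _))// prednK.
    pose phi : T := [ffun j => Ordinal (kN j)].
    have xphi : cell phi x.
      move=> j; rewrite ffunE/=; have /andP[c0 c1] := cN j.
      have xE : x ord0 j = a + c j * w by rewrite /c divfK ?gt_eqF// subrKC.
      rewrite xE !lerD2l !ler_pM2r//; apply/andP; split.
        apply: (@le_trans _ _ (Num.truncn (c j))%:R); first by rewrite ler_nat geq_minl.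
        by rewrite truncn_le.
      have [tN|tN] := leqP (Num.truncn (c j)) N.-1.
        by rewrite ltW// truncnS_gt.
      by rewrite prednK.
    exists (enum_rank phi : 'I_#|T|) => //; rewrite /U.
    by rewrite valK enum_rankK.
  rewrite (nneseries_split 0%N #|T|); last first.
    by move=> k _; rewrite /diam_pow; case: ifP => // _; exact: poweR_ge0.
  rewrite add0n [X in (_ + X)%E]eseries0 ?adde0; last first.
    move=> k Tk _; rewrite /diam_pow /U insubF ?eqxx//.
    by apply/negbTE; rewrite -leqNgt.
  apply: (@le_trans _ _ (\sum_(0 <= k < #|T|) ((D / N%:R) `^ s)%:E)%E).
    apply: lee_sum => k _; rewrite /diam_pow; case: ifPn => [_|Uk].
      by rewrite lee_fin powR_ge0.
    have dk0 : (0 <= diam (U k))%E by apply: diam_ge0; exact/set0P.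
    have diamE : diam (U k) = (fine (diam (U k)))%:E.
      by rewrite fineK// ge0_fin_numE//; exact: le_lt_trans (Ud k) (ltry _).
    rewrite diamE poweR_EFin lee_fin; apply: ge0_ler_powR.
    - exact: ltW.
    - by rewrite nnegrE fine_ge0.
    - by rewrite nnegrE divr_ge0// ltW.
    - by rewrite -lee_fin -diamE.
  rewrite sumEFin sumr_const_nat subn0 card_ffun !card_ord.
  by rewrite lee_fin -[leLHS]mulr_natl.
(* [N >= X] ensures both [D / N <= d] and [N^(s - n) >= D^s / e]. *)
pose X := (D `^ s / e) `^ (s - n%:R)^-1 + D / d + 1.
have sn0 : 0 < s - n%:R by rewrite subr_gt0.
have X1 : (D `^ s / e) `^ (s - n%:R)^-1 <= X.
  by rewrite /X -addrA lerDl addr_ge0// divr_ge0// ltW.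
have X2 : D / d <= X by rewrite /X -addrA addrCA lerDl addr_ge0// powR_ge0.
have X0 : 0 < X by rewrite /X ltr_wpDl// addr_ge0 ?powR_ge0// divr_ge0// ltW.
have NX : X <= (Num.truncn X).+1%:R by rewrite ltW// truncnS_gt.
exists (Num.truncn X).+1; set N := (Num.truncn X).+1 in NX *.
have N0 : 0 < N%:R :> R by [].
split => //.
  rewrite ler_pdivrMr//.
  by rewrite mulrC -ler_pdivrMr//; apply: le_trans NX.
rewrite natrX -powR_mulrn ?ler0n// powRM ?invr_ge0 ?(ltW D0)// -powR_inv1// -powRrM mulN1r.
rewrite mulrCA -powRD; last by rewrite (gt_eqF N0) implybT.
rewrite -(opprB s) powRN ler_pdivrMr ?powR_gt0// mulrC -ler_pdivrMr//.
have De0 : 0 <= D `^ s / e by rewrite divr_ge0 ?powR_ge0// ltW.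
have -> : D `^ s / e = ((D `^ s / e) `^ (s - n%:R)^-1) `^ (s - n%:R).
  by rewrite -powRrM mulVf ?powRr1// gt_eqF.
apply: ge0_ler_powR; rewrite ?nnegrE ?powR_ge0 ?(ltW sn0)//.
exact: le_trans X1 NX.
Qed.

Lemma scaled_packing_box (R : realType) (n : nat) (f : R -> 'rV[R]_n) (r : R)
    (x : 'rV[R]_n) (j : 'I_n) :
  size_cube_packing f -> 0 < r < 1 -> scaled_packing_image f r x ->
  -1 <= x ord0 j <= -1 + 3.
Proof.
move=> hf /andP[r0 r1] [t /=]; rewrite in_itv/= => /andP[t0 t1] [y [cy _] <-].
rewrite !mxE; have /andP[f0 f1] := hf t (introT andP (conj t0 t1)) j.
have : `|y ord0 j| <= 2^-1.
  by apply: (closure_coord_le _ cy) => z /(_ j); rewrite -ler_norml.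
have rt0 : 0 <= r * t by rewrite mulr_ge0// ltW.
have rt1 : r * t <= 1 by rewrite mulr_ile1// ltW.
move=> yj; have : `|r * t * y ord0 j| <= 2^-1.
  by rewrite normrM ger0_norm// -[leRHS]mul1r ler_pM.
by rewrite ler_norml; lra.
Qed.

(** * Lower bound *)

(** The points of the face of the cube of parameter [t] all have first coordinate
[f_1(t) + r t / 2], so only the sets close to this height can cover it, and the
face is a cube of dimension [m] and side [r t] in the remaining coordinates. *)
Lemma fibre_cover (R : realType) (m : nat) (f : R -> 'rV[R]_m.+1) (r t : R)
    (U : nat -> set 'rV[R]_m.+1) (u : nat -> 'rV[R]_m.+1) (d : nat -> R) :
  0 < r -> 0 < t < 1 ->
  (forall i, 0 <= d i) ->
  (forall i x, U i x -> Defs.edist x (u i) <= d i) ->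
  scaled_packing_image f r `<=` \bigcup_i U i ->
  (((r * t) ^+ m)%:E <= \sum_(0 <= i <oo)
    (if (U i != set0) && (`|f t ord0 ord0 + r * (t / 2) - u i ord0 ord0| <= d i)%R
     then (2 * d i) ^+ m else 0)%:E)%E.
Proof.
move=> r0 /andP[t0 t1] d0 Ud cov.
have rt0 : 0 < r * t by rewrite mulr_gt0.
pose g := f t ord0 ord0 + r * (t / 2).
pose coord (v : 'rV[R]_m.+1) (j : nat) := v ord0 (inord j.+1).
pose P i := (U i != set0) && (`|g - u i ord0 ord0| <= d i).
apply: (cube_volume_le_cover (c := coord (f t)) (a := fun i => coord (u i)) (P := P)) => //.
  exact: ltW.
move=> x xc.
pose p : 'rV[R]_m.+1 := \row_j (if j == ord0 then g else x j.-1).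
have pG : scaled_packing_image f r p.
  exists t; first by rewrite /= in_itv/= t0.
  exists ((r * t)^-1 *: (p - f t)); last first.
    by rewrite scalerA mulfV ?gt_eqF// scale1r subrK.
  apply: face_cube_boundary => [|j].
    by rewrite !mxE eqxx /g; field; rewrite !gt_eqF.
  have -> : ((r * t)^-1 *: (p - f t)) ord0 j = (p ord0 j - f t ord0 j) / (r * t).
    by rewrite !mxE mulrC.
  rewrite normrM normfV (gtr0_norm rt0) ler_pdivrMr// mxE.
  case: eqP => [->|/eqP j0].
    rewrite /g addrAC subrr add0r ger0_norm.
      by rewrite le_eqVlt; apply/orP; left; apply/eqP; field.
    by rewrite mulr_ge0 ?divr_ge0// ltW.
  have jpos : (0 < j)%N by rewrite lt0n.
  have jm : (j.-1 < m)%N by rewrite -ltnS prednK// ltn_ord.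
  by have := xc _ jm; rewrite /coord prednK// inord_val [_^-1 * _]mulrC.
have [i _ Uip] := cov _ pG.
have pd j : `|p ord0 j - u i ord0 j| <= d i.
  exact: le_trans (coord_le_edist _ _ _) (Ud _ _ Uip).
exists i.
  rewrite /P; apply/andP; split; first by apply/set0P; exists p.
  by have := pd ord0; rewrite mxE eqxx.
move=> j jm; have := pd (inord j.+1); rewrite mxE.
by rewrite -val_eqE/= inordK.
Qed.

(** Two elements of this set have heights at most [2 * d] apart, so the whole set
lies in the section of the near triples over any one of its elements. *)
Lemma near_preimage_mass (R : realType) (h : R -> R) (r c d M : R) (k : nat)
    (A : set R) :
  measurable_fun setT h -> measurable A -> A `<=` `]2^-1, 1[%classic ->
  0 < r < 1 -> 0 <= M -> 2 * d <= 2^-1 ^+ k ->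
  (forall t k, A t -> (near_mass h k (r, t) <= (M / near_weight k)%:E)%E) ->
  (@lebesgue_measure R ([set t | (`|face_height h r t - c| <= d)%R] `&` A) <=
   (M / near_weight k)%:E)%E.
Proof.
move=> mh mA AJ r01 M0 dk AM; set B := (X in lebesgue_measure X).
have mB : measurable B.
  apply: measurableI => //; apply: measurable_dist_le; exact: measurable_face_height.
have [->|/set0P[t0 [/= t0c At0]]] := eqVneq B set0.
  by rewrite measure0 lee_fin divr_ge0// ltW// near_weight_gt0.
apply: le_trans (AM t0 k At0).
apply: le_lebesgue_measure => //.
  by apply: measurable_xsection; exact: measurable_near_triples.
move=> t' [/= t'c At']; apply/xsectionP; split.
  by split; [split => //; exact: AJ|exact: AJ].
rewrite /= subr0.
have -> : face_height h r t0 - face_height h r t' =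
  (face_height h r t0 - c) - (face_height h r t' - c) by ring.
apply: le_trans (ler_normB _ _) _; apply: le_trans (lerD t0c t'c) _.
by move: dk; lra.
Qed.

(** By Bernoulli's inequality, with [D] the inverse of [min 1 (q - 1)]. *)
Lemma linear_le_geometric (R : realType) (q : R) : 1 < q ->
  exists2 D : R, 0 < D & forall k, k.+1%:R <= D * q ^+ k.
Proof.
move=> q1; pose e := Num.min 1 (q - 1).
have e0 : 0 < e by rewrite lt_min ltr01 subr_gt0.
have e1 : e <= 1 by rewrite ge_min lexx.
have eq : e <= q - 1 by rewrite ge_min lexx orbT.
exists e^-1; first by rewrite invr_gt0.
move=> k; rewrite mulrC ler_pdivlMr//.
elim: k => [|k IH]; first by rewrite expr0 mul1r.
have qk : 1 <= q ^+ k by rewrite exprn_ege1// ltW.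
rewrite exprS -natr1 mulrDl mul1r.
have : q ^+ k * (q - 1) >= e.
  by apply: (le_trans eq); rewrite ler_peMl// subr_ge0 ltW.
by move: IH; lra.
Qed.

Lemma powR_exprl (R : realType) (x e : R) (j : nat) : 0 <= x ->
  (x ^+ j) `^ e = (x `^ e) ^+ j.
Proof.
move=> x0; elim: j => [|j IH]; first by rewrite !expr0 powR1.
by rewrite !exprS powRM ?exprn_ge0// IH.
Qed.

(** Writing [e = m + 1 - s > 0] and [rho = 2^-k], which is comparable to [d], the
left-hand side is at most [(k + 1)^2 (k + 2) rho^(m+1)], that is
[(k + 1)^2 (k + 2) rho^e] times [rho^s]; the geometric factor [rho^e] absorbs
the polynomial. *)
Lemma mass_le_powR (R : realType) (m : nat) (s : R) : 0 <= s < m.+1%:R ->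
  exists2 C : R, 0 < C & forall (k : nat) (d : R),
    2^-1 ^+ k.+1 < 2 * d <= 2^-1 ^+ k ->
    (2 * d) ^+ m / near_weight k <= C * d `^ s.
Proof.
move=> /andP[s0 sm].
pose e : R := m.+1%:R - s; have e0 : 0 < e by rewrite subr_gt0.
(* A third of the exponent for each of the three linear factors. *)
pose q : R := 2 `^ (e / 3).
have q1 : 1 < q.
  have -> : 1 = 1 `^ (e / 3) :> R by rewrite powR1.
  by apply: gt0_ltr_powR; rewrite ?nnegrE ?divr_gt0//; lra.
have [D D0 Dk] := linear_le_geometric q1.
exists (2 * D ^+ 3 * 4 `^ s).
  by apply: mulr_gt0; [rewrite mulr_gt0 ?exprn_gt0|rewrite powR_gt0].
move=> k d /andP[dk kd].
set rho := 2^-1 ^+ k in kd *.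
have rho0 : 0 < rho by rewrite exprn_gt0// invr_gt0.
have d0 : 0 < d by move: dk; rewrite exprS -/rho; lra.
have rho4 : rho <= 4 * d by move: dk; rewrite exprS -/rho; lra.
have qe : q ^+ 3 = 2 `^ e.
  by rewrite -powR_mulrn ?powR_ge0// -powRrM divfK.
have q3 : rho `^ e * (q ^+ k) ^+ 3 = 1.
  have -> : (q ^+ k) ^+ 3 = (2 ^+ k) `^ e.
    by rewrite exprAC powR_exprl// qe.
  by rewrite -powRM ?exprn_ge0 ?(ltW rho0)// -exprMn mulVf// expr1n powR1.
have wk : (near_weight k)^-1 <= 2 * (D * q ^+ k) ^+ 3 * rho :> R.
  rewrite /near_weight invf_div -exprVn -/rho.
  rewrite ler_pM2r//.
  have k2 : k.+2%:R <= 2 * k.+1%:R :> R.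
    by rewrite -natrM ler_nat mul2n doubleS !ltnS -addnn leq_addr.
  apply: (@le_trans _ _ (k.+1%:R ^+ 2 * (2 * k.+1%:R))).
    by rewrite ler_wpM2l// exprn_ge0.
  rewrite mulrCA -exprSr ler_pM2l// lerXn2r ?nnegrE//.
  exact: le_trans (Dk k).
apply: (@le_trans _ _ (rho ^+ m * (2 * (D * q ^+ k) ^+ 3 * rho))).
  apply: ler_pM => //.
  - by rewrite exprn_ge0// mulr_ge0// ltW.
  - by rewrite invr_ge0 ltW// near_weight_gt0.
  - by rewrite lerXn2r ?nnegrE ?mulr_ge0 ?(ltW rho0) ?(ltW d0).
have -> : rho ^+ m * (2 * (D * q ^+ k) ^+ 3 * rho) =
    2 * D ^+ 3 * (rho ^+ m.+1 * (q ^+ k) ^+ 3) by rewrite exprMn [rho ^+ m.+1]exprSr; ring.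
have -> : rho ^+ m.+1 = rho `^ s * rho `^ e.
  rewrite -powRD; last by rewrite (gt_eqF rho0) implybT.
  by rewrite /e subrKC powR_mulrn// ltW.
rewrite -[X in _ * X]mulrA q3 mulr1 -[leRHS]mulrA -powRM ?(ltW d0)//.
apply: ler_wpM2l; first by rewrite mulr_ge0// exprn_ge0// ltW.
by apply: ge0_ler_powR; rewrite ?nnegrE ?mulr_ge0 ?(ltW rho0) ?(ltW d0).
Qed.

Lemma dyadic_scale (R : realType) (x : R) : 0 < x <= 1 ->
  exists k, 2^-1 ^+ k.+1 < x <= 2^-1 ^+ k.
Proof.
move=> /andP[x0 x1].
have exk : exists k, 2^-1 ^+ k.+1 < x.
  have [D D0 Dk] := @linear_le_geometric R 2 ltac:(by rewrite ltr1n).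
  exists (Num.truncn (D / x)).
  rewrite exprVn invf_plt ?posrE// ?exprn_gt0//.
  set k := Num.truncn _.
  have h1 : D / x < k.+1%:R by apply: truncnS_gt.
  have h2 := Dk k.
  have h3 : D / x < D * 2 ^+ k by exact: lt_le_trans h1 h2.
  have : x^-1 < 2 ^+ k by move: h3; rewrite ltr_pM2l.
  by move=> /lt_le_trans; apply; rewrite exprS ler_peMl ?exprn_ge0// ler1n//.
have [k kx kmin] := ex_minnP exk.
exists k; rewrite kx/=; case: k kx kmin => [|k] kx kmin; first by rewrite expr0.
by rewrite leNgt; apply/negP => /kmin; rewrite ltnn.
Qed.

Lemma hausdorff_cover (R : realType) (n : nat) (s d e : R) (G : set 'rV[R]_n) :
  hausdorff_measure s G = 0%E -> 0 < d -> 0 < e ->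
  exists U : nat -> set 'rV[R]_n, [/\ G `<=` \bigcup_i U i,
    forall i, (diam (U i) <= d%:E)%E &
    (\sum_(0 <= i <oo) diam_pow s (U i) < e%:E)%E].
Proof.
move=> G0 d0 e0.
have : (hausdorff_content s d G < e%:E)%E.
  apply: (@le_lt_trans _ _ 0%E); last by rewrite lte_fin.
  by rewrite -G0; apply: ereal_sup_ubound; exists d.
by move=> /ereal_inf_lt[_ [U [UG Ud] <-] Ue]; exists U.
Qed.

(** If the measure were zero, there would be covers with arbitrarily small sums of
[d_i^s].  But integrating [fibre_cover] over [A] bounds [(r / 2)^m] times the
measure of [A] by the sum of [(2 d_i)^m] times the measure of the [t] whose
face is within [d_i] of the [i]-th set, which is at most a constant times the
sum of [d_i^s]. *)
Lemma scaled_packing_hausdorff_measure_neq0 (R : realType) (m : nat)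
    (f : R -> 'rV[R]_m.+1) (h : R -> R) (r s M : R) (A : set R) :
  (0 < m)%N -> 0 < r < 1 -> 0 <= s < m.+1%:R ->
  measurable_fun setT h ->
  (forall t, 0 < t < 1 -> h t = f t ord0 ord0) ->
  measurable A -> A `<=` `]2^-1, 1[%classic ->
  (0 < @lebesgue_measure R A)%E -> 0 < M ->
  (forall t k, A t -> (near_mass h k (r, t) <= (M / near_weight k)%:E)%E) ->
  hausdorff_measure s (scaled_packing_image f r) <> 0%E.
Proof.
move=> m0 r01 sm mh hf mA AJ A0 M0 AM H0.
have /andP[r0 r1] := r01.
have [C C0 massC] := mass_le_powR sm.
have A12 t : A t -> 2^-1 < t < 1 by move=> /AJ; rewrite /= in_itv.
have Afin : @lebesgue_measure R A \is a fin_num.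
  rewrite ge0_fin_numE ?measure_ge0//.
  apply: (@le_lt_trans _ _ (@lebesgue_measure R `]2^-1, 1[%classic)).
    by apply: le_lebesgue_measure => //; exact: measurable_itv.
  by rewrite lebesgue_measure_itv/=; case: ifP => _; rewrite -?EFinB ltry.
pose a := fine (@lebesgue_measure R A).
have aE : @lebesgue_measure R A = a%:E by rewrite /a fineK.
have a0 : 0 < a by rewrite -lte_fin -aE.
pose L := (r / 2) ^+ m; have L0 : 0 < L by rewrite exprn_gt0// divr_gt0.
have e0 : 0 < L * a / (M * C) by rewrite divr_gt0// mulr_gt0.
(* Diameters at most 1/4 keep [2 * d i] at most 1, so that it has a dyadic
   scale. *)
have quarter0 : 0 < 4^-1 :> R by rewrite invr_gt0.
have [U [UG Ud Ue]] := hausdorff_cover H0 quarter0 e0.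
pose d i := if U i == set0 then 0 else fine (diam (U i)).
pose u i := xget 0 (U i).
have dE i : U i != set0 -> diam (U i) = (d i)%:E.
  move=> Ui; rewrite /d (negbTE Ui) fineK// ge0_fin_numE.
    exact: le_lt_trans (Ud i) (ltry _).
  by apply: diam_ge0; exact/set0P.
have d0 i : 0 <= d i.
  have [/eqP Ui|Ui] := boolP (U i == set0); first by rewrite /d Ui eqxx.
  by rewrite -lee_fin -dE//; apply: diam_ge0; exact/set0P.
have uU i x : U i x -> Defs.edist x (u i) <= d i.
  move=> Uix; have Ui : U i != set0 by apply/set0P; exists x.
  rewrite -lee_fin -dE//; apply: edist_le_diam => //; exact: (xgetPex _ (ex_intro _ x Uix)).
pose b i := if U i != set0 then (2 * d i) ^+ m else 0.
have b0 i : 0 <= b i by rewrite /b; case: ifP => // _; rewrite exprn_ge0 ?mulr_ge0.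
pose E i := [set t | `|face_height h r t - u i ord0 ord0| <= d i].
have mE i : measurable (E i) by apply: measurable_dist_le; exact: measurable_face_height.
have step1 : (L%:E * @lebesgue_measure R A <=
    \sum_(0 <= i <oo) ((b i)%:E * @lebesgue_measure R (E i `&` A)))%E.
  apply: mule_measure_le_nneseries => //; first exact: ltW.
  move=> t At; have /andP[t12 t1] := A12 t At.
  have t0 : 0 < t by lra.
  have t01 : 0 < t < 1 by rewrite t0.
  apply: (@le_trans _ _ ((r * t) ^+ m)%:E).
    rewrite lee_fin lerXn2r ?nnegrE ?mulr_ge0 ?divr_ge0 ?ltW//.
    by rewrite ltr_pM2l.
  apply: le_trans (fibre_cover r0 t01 d0 uU UG) _.
  apply: lee_nneseries => [i _ _|i _].
    by rewrite lee_fin; case: ifP => // _; rewrite exprn_ge0 ?mulr_ge0.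
  rewrite lee_fin /b indicE -(hf _ t01) -/(face_height h r t).
  case: (U i != set0) => /=; last by rewrite mul0r.
  case: ifPn => [tE|_]; first by rewrite mem_set// mulr1.
  by rewrite mulr_ge0// exprn_ge0// mulr_ge0.
have step2 i : ((b i)%:E * @lebesgue_measure R (E i `&` A) <=
    (M * C)%:E * diam_pow s (U i))%E.
  rewrite /diam_pow /b; case: ifPn => [Ui|]; last first.
    by rewrite negbK => ->; rewrite mul0e mule0.
  rewrite (negbTE Ui) dE// poweR_EFin.
  (* Sets of diameter zero contribute nothing, because [m] is positive. *)
  have := d0 i; rewrite le_eqVlt => /predU1P[<-|di0].
    rewrite mulr0 expr0n gtn_eqF// mul0e -EFinM lee_fin.
    by rewrite mulr_ge0 ?powR_ge0// mulr_ge0// ltW.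
  have di1 : 0 < 2 * d i <= 1.
    rewrite mulr_gt0//=; have := Ud i; rewrite dE// lee_fin; lra.
  have [k kd] := dyadic_scale di1; have /andP[_ dk] := kd.
  apply: (@le_trans _ _ (((2 * d i) ^+ m)%:E * (M / near_weight k)%:E)%E).
    apply: lee_wpmul2l; first by rewrite lee_fin exprn_ge0// ltW// mulr_gt0.
    exact: (near_preimage_mass _ mh mA AJ r01 (ltW M0) dk AM).
  rewrite -!EFinM lee_fin mulrCA -mulrA ler_pM2l//.
  exact: massC.
have : (L%:E * a%:E <= (M * C)%:E * \sum_(0 <= i <oo) diam_pow s (U i))%E.
  rewrite -aE; apply: le_trans step1 _.
  rewrite -nneseriesZl; last first.
    by move=> i _; rewrite /diam_pow; case: ifP => // _; exact: poweR_ge0.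
  apply: lee_nneseries => [i _ _|i _]; last exact: step2.
  by rewrite mule_ge0// lee_fin.
apply/negP; rewrite -ltNge.
by rewrite -lte_pdivlMl ?mulr_gt0// -!EFinM mulrC.
Qed.

Lemma measurable_fun_coord0 (R : realType) (m : nat) (D : set R)
    (f : R -> 'rV[R]_m.+1) :
  measurable_fun D (f : R -> g_sigma_algebraType (@open 'rV[R]_m.+1)) ->
  measurable_fun D (fun t => f t ord0 ord0).
Proof.
move=> mf mD; apply: (measurability _ (RGenOpens.measurableE R)) => //.
move=> _ [_ [a [b ->] <-]].
have oV : open [set v : 'rV[R]_m.+1 | `]a, b[%classic (v ord0 ord0)].
  apply: (@open_comp _ _ (fun v : 'rV[R]_m.+1 => v ord0 ord0)).
    by move=> v _; exact: coord_continuous.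
  exact: interval_open.
apply: (mf mD [set v | `]a, b[%classic (v ord0 ord0)]).
exact: sub_sigma_algebra.
Qed.

Unset Implicit Arguments.
Set Strict Implicit.
Set Printing Implicit Defensive.

Theorem theorem1p5 (R : realType) (n : nat) (hn : (2 <= n)%N)
    (f : R -> 'rV[R]_n) (hf : measurable_size_cube_packing f) :
  {ae @lebesgue_measure R, forall r : R, 0 < r < 1 ->
    hausdorff_dim (scaled_packing_image f r) = (n%:R)%:E}.
Proof.
case: n hn f hf => // m hm f [fcube mf].
(* [f] is arbitrary outside the open unit interval, so its first coordinate
   is cut off there to obtain a measurable function on the line. *)
pose h : R -> R := (fun t => f t ord0 ord0) \_ `]0, 1[.
have mh : measurable_fun setT h.
  apply/(measurable_restrictT _ (measurable_itv _)).
  exact: measurable_fun_coord0.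
have hE t : 0 < t < 1 -> h t = f t ord0 ord0.
  by move=> t01; rewrite /h patchE mem_set//= in_itv.
apply: filterS (near_mass_bound_ae mh).
  exact: (ae_filter_ringOfSetsType (@lebesgue_measure R)).
move=> r [A [M [mA AJ A0 M0 AM]]] r01.
apply/eqP; rewrite eq_le; apply/andP; split.
  apply/lee_addgt0Pr => e e0; apply: ereal_inf_lbound; exists (m.+1%:R + e) => //.
  split; first by rewrite addr_ge0// ltW.
  apply: (@hausdorff_measure_box_eq0 _ _ _ _ (-1) 3) => //; first by rewrite ltrDl.
  by move=> x j; exact: scaled_packing_box.
apply: le_ereal_inf_tmp => _ [s [s0 Hs0] <-]; rewrite lee_fin leNgt.
apply/negP => sm.
by apply: (scaled_packing_hausdorff_measure_neq0 _ r01 _ mh hE mA AJ A0 M0 AM Hs0); rewrite ?s0.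
Qed.
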